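(* Suppose $\mathbb{R}^n$ and $\mathbb{R}^m$ are endowed with (arbitrary) norms, both denoted $\|\cdot\|$. Let $A\in\mathbb{R}^{m\times n}$, let $g:\mathbb{R}^m\to\mathbb{R}\cup\{\infty\}$ be convex and differentiable, and let $f=g\circ A$. Let $X\subseteq\mathbb{R}^n$ be a polyhedron with $X\subseteq\mathrm{dom}(f)$ such that $A(X)$ has more than one point. Let $D:X\times X\to\mathbb{R}_+$ be a distance-like function with $D(y,x)\le\frac12\|y-x\|^2$ for all $x,y\in X$. Assume that $f^\star:=\min_{x\in X}f(x)$ is finite, that $X^\star:=\{x\in X:f(x)=f^\star\}\neq\emptyset$, and that the map $x\mapsto\bar x:=\mathrm{argmin}_{y\in X^\star}D(y,x)$ is well defined for all $x\in X$. If $g$ is $\mu_g$-strongly convex for the norm in $\mathbb{R}^m$ then \[ \mu^\star_{f,X,D}\ \ge\ \inf_{C\in\mathcal{T}(A|X,X^\star)}\frac{\mu_g}{\|(A|C)^{-1}\|^2}. \]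
   Context: Distance-like: $D(y,x)\ge 0$ and $D(x,x)=0$ for all $x,y\in X$. The point $\bar x$ is a minimizer of $D(\cdot,x)$ over $X^\star$ (a fixed choice of one if it is not unique). Bregman distance: $D_f(y,x)=f(y)-f(x)-\langle\nabla f(x),y-x\rangle$. The relative quasi-strong convexity constant is \[ \mu^\star_{f,X,D}:=\sup\{\mu\ge0:\ D_f(\bar x,x)\ge\mu\,D(\bar x,x)\text{ for all }x\in X\}. \] $g$ is $\mu_g$-strongly convex for $\|\cdot\|$ (with $\mu_g>0$) if $D_g(v,u)\ge\frac{\mu_g}{2}\|v-u\|^2$ for all $u,v\in\mathrm{dom}(g)$. For a convex cone $C\subseteq\mathbb{R}^n$ (not necessarily containing $0$), \[ \|(A|C)^{-1}\|:=\sup_{v\in A(C),\,\|v\|\le1}\ \inf_{x\in C,\,Ax=v}\|x\|, \] with the convention $1/0=+\infty$. For nonempty $S\subseteq X$, $\mathcal{T}(A|X,S):=\{T_X(x;A,S):x\in X\}$ where \[ T_X(x;A,S):=\{d\in\mathbb{R}^n:\ x+td\in X\text{ and }A(x+td)\in\mathrm{conv}(A(S))\text{ for some }t>0\}. \] *)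

(* Defs.v *)
From mathcomp Require Export all_boot all_order all_algebra.
From mathcomp Require Export all_classical all_reals all_analysis.
Export Order.TTheory GRing.Theory Num.Theory.
Export numFieldNormedType.Exports.

Set Implicit Arguments.
Unset Strict Implicit.
Unset Printing Implicit Defensive.

Local Open Scope classical_set_scope.
Local Open Scope ring_scope.

(* Norms are explicit functions because the canonical norm of ['cV[R]_n] is the
   sup norm. The canonical one is used only for the topology, i.e., for
   neighbourhoods and differentials, which are the same for every norm. *)
Record is_norm (R : realType) (V : lmodType R) (N : V -> R) : Prop := IsNorm {
  is_norm_triangle : forall x y, N (x + y) <= N x + N y ;
  is_norm_scale : forall (a : R) x, N (a *: x) = `|a| * N x ;
  is_norm_eq0 : forall x, N x = 0 -> x = 0 }.

Definition polyhedron (R : realType) (n : nat) (X : set 'cV[R]_n) : Prop :=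
  exists (p : nat) (M : 'M[R]_(p, n)) (b : 'cV[R]_p),
    X = [set x | forall i, (M *m x) i ord0 <= b i ord0].

Definition conv_hull (R : realType) (V : lmodType R) (S : set V) : set V :=
  smallest (@convex_set R V) S.

Section ExtendedValued.
Local Open Scope ereal_scope.

Definition edom (R : realType) (V : Type) (g : V -> \bar R) : set V :=
  [set u | g u < +oo].

Definition econvex (R : realType) (V : lmodType R) (g : V -> \bar R) : Prop :=
  forall (u v : V) (t : R), (0 <= t <= 1)%R ->
    g (t *: u + (1 - t) *: v)%R <= t%:E * g u + (1 - t)%:E * g v.

(* The first conjunct, that [g] is finite around each point of its domain, is
   needed because [fine +oo = 0]. *)
Definition edifferentiable (R : realType) (V : normedModType R)
    (g : V -> \bar R) : Prop :=
  forall u, edom g u ->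
    (\forall v \near u, edom g v) /\ differentiable (fine \o g) u.

(* The differential at [x] applied to [h] is [<grad f x, h>]. *)
Definition bregman (R : realType) (V : normedModType R) (f : V -> \bar R)
    (y x : V) : \bar R :=
  f y - f x - ('d (fine \o f) x (y - x)%R)%:E.

Definition strongly_convex (R : realType) (V : normedModType R) (N : V -> R)
    (mu : R) (g : V -> \bar R) : Prop :=
  forall u v, edom g u -> edom g v ->
    (mu / 2 * N (v - u) ^+ 2)%:E <= bregman g v u.

Definition min_value (R : realType) (V : Type) (f : V -> \bar R) (X : set V) :
    \bar R :=
  ereal_inf (f @` X).

Definition minimizers (R : realType) (V : Type) (f : V -> \bar R)
    (X : set V) : set V :=
  [set x | X x /\ f x = min_value f X].

Definition distance_like (R : realType) (V : Type) (X : set V)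
    (D : V -> V -> R) : Prop :=
  (forall x y, X x -> X y -> (0 <= D y x)%R) /\ (forall x, X x -> D x x = 0%R).

(* [bar] is any choice, for each [x] in [X], of a minimizer of [D _ x] on [S]. *)
Definition argmin_map (R : realType) (V : Type) (X S : set V)
    (D : V -> V -> R) (bar : V -> V) : Prop :=
  forall x, X x -> S (bar x) /\ (forall y, S y -> (D (bar x) x <= D y x)%R).

Definition quasi_strong_convexity_constant (R : realType)
    (V : normedModType R) (f : V -> \bar R) (X : set V) (D : V -> V -> R)
    (bar : V -> V) : \bar R :=
  ereal_sup [set mu%:E | mu in [set mu : R | (0 <= mu)%R /\
    forall x, X x -> (mu * D (bar x) x)%:E <= bregman f (bar x) x]].

Definition inv_norm (R : realType) (m n : nat) (Nn : 'cV[R]_n -> R)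
    (Nm : 'cV[R]_m -> R) (A : 'M[R]_(m, n)) (C : set 'cV[R]_n) : \bar R :=
  ereal_sup [set ereal_inf [set (Nn x)%:E | x in [set x | C x /\ A *m x = v]]
            | v in [set v | (mulmx A @` C) v /\ (Nm v <= 1)%R]].

End ExtendedValued.

Definition tangent_set (R : realType) (m n : nat) (A : 'M[R]_(m, n))
    (X S : set 'cV[R]_n) (x : 'cV[R]_n) : set 'cV[R]_n :=
  [set d | exists t : R, [/\ 0 < t, X (x + t *: d) &
    conv_hull (mulmx A @` S) (A *m (x + t *: d))]].

Definition tangent_sets (R : realType) (m n : nat) (A : 'M[R]_(m, n))
    (X S : set 'cV[R]_n) : set (set 'cV[R]_n) :=
  [set tangent_set A X S x | x in X].

(* Main.v *)
(* Strong convexity of [g] forces all minimizers of [f] on [X] to have the same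
   image [b] under [A]. Hence, for [x] in [X], the vectors of the tangent set [C]
   at [x] that [A] maps to [(b - A x) / |b - A x|] are the [(y - x) / |b - A x|]
   with [y] a minimizer, so any lower bound [r] of the distances from [x] to the
   minimizers satisfies [r / |b - A x| <= |(A|C)^-1|]. Taking
   [r = sqrt (2 D(bar x, x))] and combining with
   [D_f(bar x, x) = D_g(b, A x) >= mu_g / 2 * |b - A x|^2] gives the bound. *)
Require Import Defs.
From mathcomp Require Import lra.

Local Open Scope classical_set_scope.
Local Open Scope ring_scope.

Section Norms.
Context {R : realType} {V : lmodType R} {N : V -> R} (hN : is_norm N).

Lemma is_norm0 : N 0 = 0.
Proof. by rewrite -(scale0r 0) (is_norm_scale hN) normr0 mul0r. Qed.

Lemma is_norm_ge0 x : 0 <= N x.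
Proof.
have := is_norm_triangle hN x (- x).
rewrite subrr is_norm0 -scaleN1r (is_norm_scale hN) normrN1 mul1r; lra.
Qed.

Lemma is_norm_gt0 x : x != 0 -> 0 < N x.
Proof.
move=> x0; rewrite lt_neqAle is_norm_ge0 andbT eq_sym.
by apply: contraNneq x0 => /(is_norm_eq0 hN)/eqP.
Qed.

End Norms.

(** [A *m v] is a finite sum of fixed columns of [A] weighted by the coordinates of [v], each of
    which is continuous. *)
Lemma mulmx_continuous {R : realType} (m n : nat) (A : 'M[R]_(m, n)) :
  continuous (mulmx A : 'cV[R]_n -> 'cV[R]_m).
Proof.
rewrite (_ : mulmx A = fun v : 'cV[R]_n => \sum_j v j 0 *: col j A); last first.
  apply/funext => v; apply/colP => i; rewrite mxE summxE.
  by apply: eq_bigr => j _; rewrite !mxE mulrC.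
apply: continuous_big => [|j _ v]; first exact: add_continuous.
by apply: (@cvgZr_tmp _ _ _ (nbhs v)); exact: (@coord_continuous R n 1 j 0 v).
Qed.

(** Chain rule: a continuous linear map is its own differential. *)
Lemma bregman_comp_mulmx {R : realType} (m n : nat) (A : 'M[R]_(m, n))
    (g : 'cV[R]_m -> \bar R) (x y : 'cV[R]_n) :
  differentiable (fine \o g) (A *m x) ->
  bregman (g \o mulmx A) y x = bregman g (A *m y) (A *m x).
Proof.
move=> dg; have cA := @mulmx_continuous R m n A.
rewrite /bregman /= -(mulmxBr A y x); congr (_ - _%:E)%E.
rewrite (_ : fine \o _ = (fine \o g) \o mulmx A) //.
rewrite diff_comp //; last exact: linear_differentiable.
by rewrite /= diff_lin.
Qed.

Lemma polyhedron_convex {R : realType} (n : nat) (X : set 'cV[R]_n) u v (t : R) :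
  polyhedron X -> X u -> X v -> 0 <= t <= 1 -> X (t *: u + (1 - t) *: v).
Proof.
move=> [p [M [b ->]]] /= Xu Xv /andP[t0 t1] i.
rewrite mulmxDr -!scalemxAr !mxE.
have := Xu i; have := Xv i; rewrite !mxE; nra.
Qed.

Lemma strongly_convex_ge0_bregman {R : realType} {V : normedModType R}
    (N : V -> R) (mu : R) (g : V -> \bar R) u v :
  0 <= mu -> strongly_convex N mu g -> edom g u -> edom g v ->
  (0 <= bregman g v u)%E.
Proof.
move=> mu0 gsc gu gv; apply: le_trans (gsc _ _ gu gv).
by rewrite lee_fin mulr_ge0 ?sqr_ge0// divr_ge0.
Qed.

(* The linear terms of the Bregman distances from the midpoint cancel. *)
Lemma strongly_convex_midpoint {R : realType} {V : normedModType R}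
    (N : V -> R) (mu : R) (g : V -> \bar R) u v :
  is_norm N -> 0 < mu -> strongly_convex N mu g ->
  (forall w, g w != -oo%E) -> edom g u -> edom g v ->
  (g u <= g (2^-1 *: (u + v)))%E -> (g v <= g (2^-1 *: (u + v)))%E ->
  edom g (2^-1 *: (u + v)) -> u = v.
Proof.
move=> hN mu0 gsc gNy gu gv; set w := 2^-1 *: _ => guw gvw gw.
have vwE : v - w = - (u - w).
  apply/eqP; rewrite -addr_eq0 addrACA -opprD -scalerDl.
  by rewrite (_ : 2^-1 + 2^-1 = 1 :> R) ?scale1r ?[v + u]addrC ?subrr//; lra.
have := gsc _ _ gw gu; have := gsc _ _ gw gv.
rewrite /bregman vwE linearN/=.
move: gu gv gw guw gvw (gNy u) (gNy v) (gNy w); rewrite /edom/=.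
case: (g u) => [gu||]//; case: (g v) => [gv||]//; case: (g w) => [gw||]// _ _ _.
rewrite !lee_fin => guw gvw _ _ _ /[swap].
set d := 'd _ _ _ => Bu Bv.
(* In [Bu + Bv] the terms in [d] cancel, and the right side is at most 0 because neither [gu] nor
   [gv] exceeds the value at [w]. *)
have uw : u - w = 0.
  apply: (is_norm_eq0 hN); apply/eqP; rewrite -sqrf_eq0; apply/eqP/le_anti.
  by rewrite sqr_ge0 andbT; have := sqr_ge0 (N (- (u - w))); nra.
by transitivity w; [|apply/esym]; apply: subr0_eq; rewrite ?vwE uw ?oppr0.
Qed.

Lemma conv_hull1 {R : realType} (V : lmodType R) (b : V) :
  conv_hull [set b] = [set b].
Proof.
apply: smallest_id => x y t; rewrite !inE /= => -> ->.
by rewrite convmm.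
Qed.

Lemma inv_norm_tangent_ge {R : realType} {m n : nat}
    {Nn : 'cV[R]_n -> R} {Nm : 'cV[R]_m -> R} {A : 'M[R]_(m, n)}
    {X S : set 'cV[R]_n} {x : 'cV[R]_n} {b : 'cV[R]_m} {r : R} :
  is_norm Nn -> is_norm Nm -> mulmx A @` S = [set b] ->
  (exists2 y, X y & A *m y = b) ->
  (forall y, X y -> A *m y = b -> r <= Nn (y - x)) -> A *m x != b ->
  ((r / Nm (b - A *m x))%:E <= inv_norm Nn Nm A (tangent_set A X S x))%E.
Proof.
move=> hNn hNm ASb [y Xy Ayb] rmin Axb.
have v0 : b - A *m x != 0 by rewrite subr_eq0 eq_sym.
have N0 := is_norm_gt0 hNm _ v0.
set N := Nm _ in N0 *.
have Nneq0 : N != 0 by rewrite gt_eqF.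
rewrite /inv_norm; apply: le_trans; last first.
  apply: ereal_sup_ubound; exists (N^-1 *: (b - A *m x)) => //; split.
    (* This direction is in the tangent set: a step of length [N] along it leads from [x] to [y]. *)
    exists (N^-1 *: (y - x)); last by rewrite -scalemxAr mulmxBr Ayb.
    exists N; rewrite scalerA divff// scale1r [x + _]addrC subrK ASb conv_hull1.
    by split.
  by rewrite (is_norm_scale hNm) gtr0_norm ?invr_gt0// mulVf.
apply/ereal_infP => _ [d [[t [t0 Xd Adb]] Ad] <-].
move: Adb; rewrite ASb conv_hull1 /= lee_fin => Adb.
(* [A *m d] is the normalized vector, so only a step of length [N] can reach [b]. Then [rmin]
   applies to the endpoint [x + N *: d]. *)
have tN : t = N.
  have : t *: (A *m d) = b - A *m x.
    by rewrite -Adb mulmxDr [A *m x + _]addrC addrK -scalemxAr.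
  rewrite Ad scalerA => /(congr1 (fun u => u - (b - A *m x)))/eqP.
  rewrite subrr -{2}[b - _]scale1r -scalerBl scaler_eq0 (negPf v0) orbF.
  by rewrite subr_eq0 => /eqP/divr1_eq.
have := rmin _ Xd Adb.
rewrite [x + _]addrC addrK (is_norm_scale hNn) gtr0_norm// tN => rd.
by rewrite ler_pdivrMr// mulrC.
Qed.

(** Positivity of [q] keeps [L] away from 0, where the inverse is [+oo]. If [L] is [+oo], the
    quotient is 0 and forces [c <= 0]. *)
Lemma le_div_sqr_ereal {R : realType} {a c q : R} {L : \bar R} :
  0 <= a -> 0 < q -> (q%:E <= L)%E -> (c%:E <= a%:E / L ^+ 2)%E ->
  c * q ^+ 2 <= a.
Proof.
move=> a0 q0; case: L => [l||]//; last first.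
  rewrite expe2 mulyy invey mule0 lee_fin => _ c0.
  by apply: le_trans a0; rewrite mulr_le0_ge0// sqr_ge0.
rewrite lee_fin => ql; have l0 := lt_le_trans q0 ql.
rewrite -EFin_expe inver gt_eqF ?exprn_gt0// -EFinM lee_fin ler_pdivlMr ?exprn_gt0//.
have q2l2 : q ^+ 2 <= l ^+ 2 by rewrite lerXn2r// nnegrE ltW.
have [c0 _|/ltW c0] := leP c 0; last exact/le_trans/ler_wpM2l.
by apply: le_trans a0; rewrite mulr_le0_ge0// sqr_ge0.
Qed.

(* In the extended reals of the library, 0^-1 = +oo and +oo^-1 = 0. *)
Theorem theorem3 (R : realType) (m n : nat)
    (Nn : 'cV[R]_n -> R) (Nm : 'cV[R]_m -> R)
    (hNn : is_norm Nn) (hNm : is_norm Nm)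
    (A : 'M[R]_(m, n))
    (g : 'cV[R]_m -> \bar R)
    (g_proper : forall u, g u != -oo%E)
    (g_convex : econvex g)
    (g_diff : edifferentiable g)
    (f : 'cV[R]_n -> \bar R)
    (f_def : f = g \o mulmx A)
    (X : set 'cV[R]_n)
    (X_polyhedron : polyhedron X)
    (X_dom : X `<=` edom f)
    (AX_two_points : exists u v, [/\ (mulmx A @` X) u, (mulmx A @` X) v & u != v])
    (D : 'cV[R]_n -> 'cV[R]_n -> R)
    (D_distance_like : distance_like X D)
    (D_le : forall x y, X x -> X y -> D y x <= 2^-1 * Nn (y - x) ^+ 2)
    (fstar_finite : min_value f X \is a fin_num)
    (Xstar_nonempty : minimizers f X !=set0)
    (bar : 'cV[R]_n -> 'cV[R]_n)
    (bar_argmin : argmin_map X (minimizers f X) D bar)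
    (mu_g : R)
    (mu_g_gt0 : 0 < mu_g)
    (g_strongly_convex : strongly_convex Nm mu_g g) :
  (ereal_inf [set mu_g%:E / inv_norm Nn Nm A C ^+ 2
             | C in tangent_sets A X (minimizers f X)]
   <= quasi_strong_convexity_constant f X D bar)%E.
Proof.
have gdA x (Xx : X x) : edom g (A *m x) by have := X_dom _ Xx; rewrite f_def.
have fE x : f x = g (A *m x) by rewrite f_def.
have fstar_le y : X y -> (min_value f X <= f y)%E.
  by move=> Xy; apply: ereal_inf_lbound; exists y.
have [x0 [Xx0 fx0]] := Xstar_nonempty.
(* By convexity of [X], the midpoint of two minimizers is feasible, so [f] is no smaller there than
   at the minimizers. *)
have A_const y : minimizers f X y -> A *m y = A *m x0.
  move=> [Xy fy].
  have Xmid : X (2^-1 *: (y + x0)).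
    have := @polyhedron_convex _ _ _ y x0 2^-1 X_polyhedron Xy Xx0.
    by rewrite (_ : 1 - 2^-1 = 2^-1 :> R) -?scalerDr; [apply|]; lra.
  have := fstar_le _ Xmid; have := gdA _ Xmid; rewrite fE -scalemxAr mulmxDr => gw gle.
  apply: (@strongly_convex_midpoint R 'cV[R]_m Nm mu_g g _ _
    hNm mu_g_gt0 g_strongly_convex) => //.
  - exact: gdA.
  - exact: gdA.
  - by rewrite -fE fy.
  - by rewrite -fE fx0.
have AS : mulmx A @` minimizers f X = [set A *m x0].
  apply/seteqP; split => [_ [y Sy <-]|_ ->]; first exact: A_const.
  by exists x0.
have minE y : X y -> A *m y = A *m x0 -> minimizers f X y.
  by move=> Xy Ay; split=> //; rewrite fE Ay -fE.
have bregE x y : X x -> X y -> bregman f y x = bregman g (A *m y) (A *m x).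
  by move=> Xx Xy; rewrite f_def bregman_comp_mulmx//; case: (g_diff _ (gdA _ Xx)).
have Xbar x : X x -> X (bar x) by move=> /bar_argmin[[]].
have breg_ge0 x y : X x -> X y -> (0 <= bregman f y x)%E.
  move=> Xx Xy; rewrite bregE//.
  exact: (@strongly_convex_ge0_bregman R 'cV[R]_m _ _ _ _ _ (ltW mu_g_gt0)
    g_strongly_convex (gdA _ Xx) (gdA _ Xy)).
set I := ereal_inf _.
(* The supremum ranges over nonnegative reals, whereas [I] may be infinite; hence the detour through
   real [c] below [I]. *)
have valid (c : R) : 0 <= c -> (c%:E <= I)%E ->
    (c%:E <= quasi_strong_convexity_constant f X D bar)%E.
  move=> c0 cI; apply: ereal_sup_ubound; exists c => //; split=> // x Xx.
  have [Sbar barmin] := bar_argmin _ Xx.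
  have D0 := D_distance_like.1 _ _ Xx (Xbar _ Xx).
  have [Dle|Dgt] := leP (D (bar x) x) 0.
    have -> : D (bar x) x = 0 by apply/le_anti/andP.
    by rewrite mulr0; apply: breg_ge0 => //; exact: Xbar.
  (* Otherwise [x] is itself a minimizer, and [D (bar x) x <= D x x = 0]. *)
  have Axb : A *m x != A *m x0.
    apply: contraTneq Dgt => /(minE _ Xx)/barmin.
    by rewrite (D_distance_like.2 _ Xx) -leNgt.
  rewrite bregE//; last exact: Xbar.
  apply: le_trans (g_strongly_convex _ _ (gdA _ Xx) (gdA _ (Xbar _ Xx))).
  rewrite lee_fin (A_const _ Sbar); set N := Nm _.
  have N0 : 0 < N by rewrite is_norm_gt0// subr_eq0 eq_sym.
  (* Chosen so that [r ^+ 2 / 2 = D (bar x) x <= D y x <= Nn (y - x) ^+ 2 / 2] for every minimizer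
     [y]. *)
  pose r := Num.sqrt (2 * D (bar x) x).
  have r2 : r ^+ 2 = 2 * D (bar x) x by rewrite sqr_sqrtr// mulr_ge0.
  have r0 : 0 < r by rewrite sqrtr_gt0 mulr_gt0.
  have rmin y : X y -> A *m y = A *m x0 -> r <= Nn (y - x).
    move=> Xy Ay; rewrite -ler_sqr ?nnegrE ?(ltW r0) ?(is_norm_ge0 hNn)// r2.
    have := barmin _ (minE _ Xy Ay); have := D_le _ _ Xx Xy; lra.
  have rL := inv_norm_tangent_ge hNn hNm AS (ex_intro2 _ _ _ Xx0 erefl) rmin Axb.
  have cL := le_trans cI (ereal_inf_lbound (ex_intro2 _ _ _ (ex_intro2 _ _ x Xx erefl) erefl)).
  have := le_div_sqr_ereal (ltW mu_g_gt0) (divr_gt0 r0 N0) rL cL.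
  by rewrite expr_div_n r2 mulrA ler_pdivrMr ?exprn_gt0//; lra.
(* The constant 0 is always admissible, which settles [I <= 0]. *)
have valid0 : (0 <= quasi_strong_convexity_constant f X D bar)%E.
  apply: ereal_sup_ubound; exists 0 => //; split=> // x Xx.
  by rewrite mul0r; apply: breg_ge0 => //; exact: Xbar.
have [I0|/ltW I0] := leP I 0; first exact: le_trans valid0.
case: I I0 valid => [r||] I0 valid; [exact: valid| |by []].
(* For [I = +oo], every positive real is admissible, so the supremum is [+oo]. *)
rewrite leye_eq; apply/eqP/eqyP => c c0.
by apply: valid; rewrite ?leey// ltW.
Qed.
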